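(* Let $E$ be a finite directed graph and fix $\lambda\in\mathbb{R}$. Let $\partial:C_1\to C_0$ be the boundary map of the chain complex of $E$ with parameter $\lambda$, and let $H^0=\ker(\delta)$ be the degree-zero cohomology of the dual cochain complex. Then there are nontrivial special generalized graph weights on $E$ with parameter $\lambda$ (that is, with vertex function $g\neq 0$) if and only if $H^0\neq 0$. This happens if and only if $\det(\partial)=0$.
   Context: $E=(E^0,E^1,s,r)$ is a finite directed graph with source and range maps $s,r$. For $v\in E^0$ let $B_v=\{e\in E^1: s(e)=v\}$ (the edge bundle at $v$); $v$ is a sink if $B_v=\emptyset$. A generalized graph weight on $E$ is a pair of real-valued functions $(g,\lambda)$ on $E^0$ and $E^1$ with $g(v)=\sum_{e\in B_v}\lambda(e)g(r(e))$ for every $v\in E^0$ that is not a sink; it is special if $\lambda$ is constant, and then the constant $\lambda$ is its parameter; for fixed parameter it is identified with the function $g$. Chain complex: $0\to C_1\xrightarrow{\partial}C_0\to0$, where $C_0=\bigoplus_{v\in E^0}\mathbb{R}v$ has the vertices as basis, $C_1=\bigoplus_{v\in E^0}\mathbb{R}B_v$ has as basis one formal symbol $B_v$ for each vertex $v$ (including sinks), and $\partial(B_v)=0$ if $v$ is a sink, $\partial(B_v)=\lambda\sum_{e\in B_v}r(e)-v$ otherwise. The determinant of $\partial$ is taken with respect to the bases $\{B_v\}$ and $\{v\}$. The dual cochain complex is $0\leftarrow C^1\xleftarrow{\delta}C^0\leftarrow0$, with $C^i=\mathrm{Hom}(C_i,\mathbb{R})$ and $\delta g=g\circ\partial$. 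*)

(* Defs.v *)
From HB Require Import structures.
From mathcomp Require Import all_boot all_order all_algebra.
From mathcomp Require Import reals.

Set Implicit Arguments.
Unset Strict Implicit.
Unset Printing Implicit Defensive.

Import GRing.Theory.
Local Open Scope ring_scope.

Record digraph := Digraph {
  vertex : finType;
  edge : finType;
  src : edge -> vertex;
  rng : edge -> vertex }.

Definition bundle (E : digraph) (v : vertex E) : {set edge E} :=
  [set e | src e == v].

Definition sink (E : digraph) (v : vertex E) : bool := bundle v == set0.

Definition is_weight (R : realType) (E : digraph)
    (g : {ffun vertex E -> R}) (l : {ffun edge E -> R}) : Prop :=
  forall v : vertex E, ~~ sink v -> g v = \sum_(e in bundle v) l e * g (rng e).

(* If [E] has no edges, every [a] is a parameter of the (empty) function [l]. *)
Definition is_special (R : realType) (E : digraph)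
    (l : {ffun edge E -> R}) (a : R) : Prop :=
  forall e : edge E, l e = a.

(* The free vector space on a finite set [I], as the space of coordinate
   functions, and its canonical basis. *)
Notation free_space R I := {ffun I -> R^o}.

Definition free_basis (R : realType) (I : finType) (i : I) : free_space R I :=
  [ffun j => (j == i)%:R].

Lemma free_basis_sum (R : realType) (I : finType) (c : free_space R I) :
  c = \sum_i c i *: free_basis R i.
Proof.
apply/ffunP => j; rewrite sum_ffunE (bigD1 j) //= big1 => [|i ij].
  by rewrite !ffunE eqxx addr0 [RHS]mulr1.
by rewrite !ffunE eq_sym (negPf ij) [LHS]mulr0.
Qed.

(* [C_1] has one basis symbol [B_v] per vertex [v], sinks included, so it is the
   free space on the vertices as well. *)
Notation chain0 R E := (free_space R (vertex E)).
Notation chain1 R E := (free_space R (vertex E)).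

Notation cochain0 R E := 'Hom(chain0 R E, R^o).
Notation cochain1 R E := 'Hom(chain1 R E, R^o).

Section Complex.
Variables (R : realType) (E : digraph) (a : R).

Definition boundary_bundle (v : vertex E) : chain0 R E :=
  if sink v then 0
  else a *: (\sum_(e in bundle v) free_basis R (rng e)) - free_basis R v.

Definition boundary_fun (c : chain1 R E) : chain0 R E :=
  \sum_(v : vertex E) c v *: boundary_bundle v.

Fact boundary_fun_linear : linear boundary_fun.
Proof.
move=> k c d; rewrite /boundary_fun scaler_sumr -big_split /=.
by apply: eq_bigr => v _; rewrite !ffunE scalerDl scalerA.
Qed.

HB.instance Definition _ :=
  GRing.isLinear.Build R (chain1 R E) (chain0 R E) _ boundary_fun
    boundary_fun_linear.

Definition boundary : 'Hom(chain1 R E, chain0 R E) := linfun boundary_fun.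

Lemma boundary_basis (v : vertex E) :
  boundary (free_basis R v) = boundary_bundle v.
Proof.
rewrite lfunE /= /boundary_fun (bigD1 v) //= big1 => [|w wv].
  by rewrite ffunE eqxx scale1r addr0.
by rewrite ffunE (negPf wv) scale0r.
Qed.

(* Column [j] holds the coordinates of [boundary B_j]; both bases are listed in
   the same order, that of the vertices. *)
Definition boundary_mx : 'M[R]_#|vertex E| :=
  \matrix_(i, j) boundary (free_basis R (enum_val j)) (enum_val i).

Definition det_boundary : R := \det boundary_mx.

Definition coboundary_fun (f : cochain0 R E) : cochain1 R E :=
  (f \o boundary)%VF.

Fact coboundary_fun_linear : linear coboundary_fun.
Proof.
by move=> k f h; rewrite /coboundary_fun comp_lfunDl comp_lfunZl.
Qed.

HB.instance Definition _ :=
  GRing.isLinear.Build R (cochain0 R E) (cochain1 R E) _ coboundary_fun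
    coboundary_fun_linear.

Definition coboundary : 'Hom(cochain0 R E, cochain1 R E) :=
  linfun coboundary_fun.

Definition cohomology0 : {vspace cochain0 R E} := lker coboundary.

Lemma coboundaryE (f : cochain0 R E) (c : chain1 R E) :
  coboundary f c = f (boundary c).
Proof. by rewrite lfunE /= comp_lfunE. Qed.

End Complex.

(* Main.v *)
Require Import Defs.
From HB Require Import structures.
From mathcomp Require Import all_boot all_order all_algebra.
From mathcomp Require Import reals.

Import GRing.Theory.
Local Open Scope ring_scope.

(* A cochain is determined by its values [g v] on the basis of vertices, and it
   is a cocycle exactly when [g] annihilates every [boundary B_v].  For a sink
   this condition is void, and for any other vertex it is the weight equation;
   on the other hand it says that the row vector [g] is in the left kernel of
   the matrix of the boundary. *)

Section Evaluation.
Variables (R : realType) (I : finType).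

(** The linear extension of [g] from the canonical basis to the whole free space. *)
Definition eval_fun (g : {ffun I -> R}) (c : {ffun I -> R^o}) : R^o :=
  \sum_i c i * g i.

Fact eval_fun_linear (g : {ffun I -> R}) : linear (eval_fun g).
Proof.
move=> k c d; rewrite /eval_fun scaler_sumr -big_split /=.
by apply: eq_bigr => i _; rewrite !ffunE mulrDl scalerAl.
Qed.

HB.instance Definition _ (g : {ffun I -> R}) :=
  GRing.isLinear.Build R {ffun I -> R^o} R^o _ (eval_fun g)
    (eval_fun_linear g).

Lemma eval_fun_basis (g : {ffun I -> R}) (i : I) :
  eval_fun g (free_basis R i) = g i.
Proof.
rewrite /eval_fun (bigD1 i) //= big1 => [|j ji].
  by rewrite ffunE eqxx mul1r addr0.
by rewrite ffunE (negPf ji) mul0r.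
Qed.

Lemma hom_eval_fun (f : 'Hom({ffun I -> R^o}, R^o)) (c : {ffun I -> R^o}) :
  f c = eval_fun [ffun i => f (free_basis R i)] c.
Proof.
rewrite {1}[c]free_basis_sum linear_sum; apply: eq_bigr => i _.
by rewrite linearZ ffunE.
Qed.

End Evaluation.

Arguments eval_fun {R I}.
Arguments eval_fun_basis {R I}.

Section Cocycles.
Variables (R : realType) (E : digraph) (a : R).
Implicit Types g : {ffun vertex E -> R}.

(** The pivot of the proof: each of the three conditions is compared with the existence of a nonzero
    [g] of this kind. *)
Definition annihilates g :=
  forall v, eval_fun g (boundary_bundle a v) = 0.

Lemma cohomology0_neq0P :
  cohomology0 E a != 0%VS <-> exists2 g, g != 0 & annihilates g.
Proof.
split=> [|[g g0 gB]].
  (* A nonzero subspace has a nonzero vector, here chosen by [vpick]; its values on the basis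
     provide [g]. *)
  rewrite -vpick0; set f := vpick _ => f0.
  have fker c : f (boundary E a c) = 0.
    have : f \in cohomology0 E a by exact: memv_pick.
    by rewrite memv_ker -coboundaryE => /eqP ->; rewrite lfunE.
  exists [ffun v => f (free_basis R v)].
    apply: contraNneq f0 => g0; apply/eqP/lfunP => c.
    rewrite hom_eval_fun g0 lfunE /= /eval_fun big1 // => v _.
    by rewrite ffunE mulr0.
  by move=> v; rewrite -hom_eval_fun -boundary_basis.
(* Conversely, the linear extension of [g] is a cocycle; were the cohomology zero, this cocycle and
   hence its values [g v] would vanish. *)
apply: contraNneq g0 => H0.
pose f : cochain0 R E := linfun (eval_fun g).
have : f \in cohomology0 E a.
  rewrite memv_ker; apply/eqP/lfunP => c.
  rewrite coboundaryE [RHS]lfunE /= [c]free_basis_sum !linear_sum big1 // => v _.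
  by rewrite !linearZ /= boundary_basis /f lfunE /= gB scaler0.
rewrite H0 memv0 => /eqP f0; apply/eqP/ffunP => v.
by rewrite -(eval_fun_basis g v) -[LHS](lfunE (eval_fun g)) -/f f0 lfunE
  ffunE.
Qed.

Lemma eval_boundary_bundle g v :
  eval_fun g (boundary_bundle a v) =
  if sink v then 0 else \sum_(e in bundle v) a * g (rng e) - g v.
Proof.
rewrite /boundary_bundle; case: ifP => _; first exact: linear0.
rewrite linearB linearZ linear_sum /= eval_fun_basis -mulr_sumr.
by congr (a * _ - _); apply: eq_bigr => e _; rewrite eval_fun_basis.
Qed.

(** Being special leaves only the constant function [a] for [l], and the weight equation then says
    that a difference vanishes. *)
Lemma special_weightP g :
  (exists2 l, is_weight g l & is_special l a) <-> annihilates g.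
Proof.
split=> [[l gl la] v | gB].
  rewrite eval_boundary_bundle; case: ifPn => // /gl ->.
  by apply/eqP; rewrite subr_eq0; apply/eqP/eq_bigr => e _; rewrite la.
exists [ffun=> a] => [v sv|e]; last by rewrite ffunE.
have /eqP := gB v; rewrite eval_boundary_bundle (negPf sv) subr_eq0 => /eqP <-.
by apply: eq_bigr => e _; rewrite ffunE.
Qed.

(** Pairing [g] with the coordinates in column [j] is the evaluation sum, reindexed by the
    enumeration of vertices. *)
Lemma mul_boundary_mx g j :
  ((\row_i g (enum_val i)) *m boundary_mx E a) 0 j =
  eval_fun g (boundary_bundle a (enum_val j)).
Proof.
rewrite mxE /eval_fun [RHS](reindex _ (onW_bij _ (enum_val_bij (vertex E)))).
by apply: eq_bigr => i _; rewrite !mxE boundary_basis mulrC.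
Qed.

Lemma det_boundary_eq0P :
  det_boundary E a = 0 <-> exists2 g, g != 0 & annihilates g.
Proof.
split=> [/eqP /det0P[u u0 uM]|[g g0 gB]].
  (* [det0P] gives a nonzero [u] in the left kernel; [enum_rank] turns it into a function on
     vertices. *)
  pose g : {ffun vertex E -> R} := [ffun v => u 0 (enum_rank v)].
  have gE : \row_i g (enum_val i) = u.
    by apply/rowP => i; rewrite mxE ffunE enum_valK.
  exists g => [|v].
    apply: contraNneq u0 => g0; rewrite -gE; apply/eqP/rowP => i.
    by rewrite g0 !mxE ffunE.
  by rewrite -[v]enum_rankK -mul_boundary_mx gE uM mxE.
apply/eqP/det0P; exists (\row_i g (enum_val i)).
  (* The row lists the value of [g] at every vertex, so it is zero only if [g] is. *)
  apply: contraNneq g0 => /rowP u0; apply/eqP/ffunP => v.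
  by have := u0 (enum_rank v); rewrite !mxE enum_rankK ffunE.
by apply/rowP => j; rewrite mul_boundary_mx gB mxE.
Qed.

End Cocycles.

Theorem proposition2p6 (R : realType) (E : digraph) (a : R) :
  ((exists (g : {ffun vertex E -> R}) (l : {ffun edge E -> R}),
      [/\ is_weight g l, is_special l a & g != 0])
     <-> cohomology0 E a != 0%VS)
  /\ (cohomology0 E a != 0%VS <-> det_boundary E a = 0).
Proof.
split; last by rewrite cohomology0_neq0P det_boundary_eq0P.
rewrite cohomology0_neq0P; split=> [[g [l [gl la g0]]]|[g g0 /special_weightP]].
  by exists g => //; apply/special_weightP; exists l.
by case=> l gl la; exists g, l.
Qed.
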